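(* Let $\alpha=(1+\sqrt{5})/2$ and $\beta=(1-\sqrt{5})/2$. Then for every integer $n\geq 0$, every integer $j\geq 1$, and every $x\in\mathbb{C}$, $$\sum_{k=0}^n\binom{n}{k}F_{jk}(\sqrt{5}F_j)^{n-k}B_{n-k}(x) = nF_j\bigl((\sqrt{5}x+\beta)F_j + F_{j-1}\bigr)^{n-1}$$ and $$\sum_{k=0}^n\binom{n}{k}F_{jk}(-\sqrt{5}F_j)^{n-k}B_{n-k}(x) = nF_j\bigl((\alpha-\sqrt{5}x)F_j + F_{j-1}\bigr)^{n-1}.$$
   Context: The Bernoulli polynomials $B_n(x)$ are defined by $\sum_{n\ge0}B_n(x)\frac{z^n}{n!}=\frac{ze^{xz}}{e^z-1}$ ($|z|<2\pi$). $F_n$ denotes the Fibonacci numbers: $F_0=0$, $F_1=1$, $F_n=F_{n-1}+F_{n-2}$. For $n=0$ the right-hand sides, which carry the factor $n$, are interpreted as $0$. *)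

(* Defs.v *)
From Stdlib Require Export Reals Factorial.
From Coquelicot Require Export Coquelicot.
Open Scope C_scope.

(* Not Stdlib's [Zgcd_alt.fibonacci], whose indexing starts at 1, 1. *)
Fixpoint fib (n : nat) : nat :=
  match n with
  | O => 0
  | S O => 1
  | S (S m as p) => fib p + fib m
  end.

Definition alpha : R := ((1 + sqrt 5) / 2)%R.
Definition beta : R := ((1 - sqrt 5) / 2)%R.

Definition Cexp (z : C) : C := exp (Re z) * (cos (Im z), sin (Im z)).

(* [B n x] is B_n(x).  At [z = 0] the quotient has a removable singularity
   (and the formal quotient [0 / 0] is a junk value), so that point is left out;
   the values at the other points of the disc determine every [B n x]. *)
Definition is_bernoulli (B : nat -> C -> C) : Prop :=
  forall x z : C, z <> 0 -> (Cmod z < 2 * PI)%R ->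
    is_series (fun n : nat => B n x * (z ^ n / INR (fact n)))
      (z * Cexp (x * z) / (Cexp z - 1)).

(* Main.v *)
(* With [w = sqrt 5 * F_j = alpha^j - beta^j], the exponential generating
   function of the left-hand side is
     (e^(alpha^j z) - e^(beta^j z)) / sqrt 5 * w z e^(x w z) / (e^(w z) - 1)
     = F_j z e^((beta^j + x w) z),
   because [e^(alpha^j z) = e^(beta^j z) e^(w z)], and
   [beta^j = beta F_j + F_(j-1)].  Exchanging [alpha] and [beta] changes [w]
   into [-w] and gives the second identity.  The computation takes place among
   formal power series; analysis only enters to turn the definition of the
   Bernoulli polynomials into the coefficient identity
   [(e^z - 1) * sum_k B_k(x) z^k / k! = z e^(x z)]. *)

From Stdlib Require Import Lra Lia.
Require Import Defs.

(** * Factorials and finite sums in [C] *)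

Lemma INR_fact_C_neq_0 (n : nat) : RtoC (INR (fact n)) <> 0.
Proof. intros H; apply (INR_fact_neq_0 n), RtoC_inj, H. Qed.

Lemma INR_S_C_neq_0 (n : nat) : RtoC (INR (S n)) <> 0.
Proof. intros H; apply (not_0_INR (S n)); [lia | apply RtoC_inj, H]. Qed.

Lemma INR_fact_S_C (n : nat) :
  RtoC (INR (fact (S n))) = INR (S n) * INR (fact n).
Proof. now rewrite fact_simpl, mult_INR, RtoC_mult. Qed.

(** Here and in the next lemmas, sums over a generic structure are restated with the operations of
    [C], which [ring] recognises. *)
Lemma Csum_ext (f g : nat -> C) (n : nat) :
  (forall k, (k <= n)%nat -> f k = g k) -> sum_n f n = sum_n g n.
Proof. apply sum_n_ext_loc. Qed.

Lemma Csum_Sn (f : nat -> C) (n : nat) :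
  sum_n f (S n) = (sum_n f n + f (S n) : C).
Proof. now rewrite sum_Sn. Qed.

Lemma Csum_recl (f : nat -> C) (n : nat) :
  sum_n f (S n) = (f O + sum_n (fun k => f (S k)) n : C).
Proof.
  induction n as [|n IH].
  - now rewrite Csum_Sn, !sum_O.
  - now rewrite Csum_Sn, IH, Csum_Sn, Cplus_assoc.
Qed.

Lemma Csum_scal (c : C) (f : nat -> C) (n : nat) :
  sum_n (fun k => c * f k) n = (c * sum_n f n : C).
Proof. exact (sum_n_mult_l (K := C_Ring) c f n). Qed.

Lemma Csum_plus (f g : nat -> C) (n : nat) :
  sum_n (fun k => f k + g k) n = (sum_n f n + sum_n g n : C).
Proof. exact (sum_n_plus (G := C_AbelianMonoid) f g n). Qed.

Lemma Re_sum_n (f : nat -> C) (n : nat) :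
  Re (sum_n f n) = sum_f_R0 (fun k => Re (f k)) n.
Proof.
  induction n as [|n IH].
  - now rewrite sum_O.
  - now rewrite Csum_Sn, re_plus, IH.
Qed.

(** * Formal power series over the complex numbers, as coefficient sequences *)

Definition conv (f g : nat -> C) (n : nat) : C :=
  sum_n (fun k => f k * g (n - k)%nat) n.

Definition fone (n : nat) : C := match n with O => 1 | S _ => 0 end.

(** Multiplication by the variable z. *)
Definition fshift (f : nat -> C) (n : nat) : C :=
  match n with O => 0 | S m => f m end.

(** The series of e^(a z). *)
Definition fexp (a : C) (n : nat) : C := a ^ n / INR (fact n).

Lemma conv_ext (f f' g g' : nat -> C) (n : nat) :
  (forall k, f k = f' k) -> (forall k, g k = g' k) ->
  conv f g n = conv f' g' n.
Proof. intros Hf Hg; apply Csum_ext; intros k _; now rewrite Hf, Hg. Qed.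

Lemma conv_S (f g : nat -> C) (n : nat) :
  conv f g (S n) = f O * g (S n) + conv (fun k => f (S k)) g n.
Proof. unfold conv; now rewrite Csum_recl. Qed.

Lemma conv_S_r (f g : nat -> C) (n : nat) :
  conv f g (S n) = conv f (fun k => g (S k)) n + f (S n) * g O.
Proof.
  unfold conv; rewrite Csum_Sn, Nat.sub_diag; f_equal.
  apply Csum_ext; intros k Hk; do 2 f_equal; lia.
Qed.

Lemma conv_plus_l (f f' g : nat -> C) (n : nat) :
  conv (fun k => f k + f' k) g n = conv f g n + conv f' g n.
Proof.
  unfold conv; rewrite <- Csum_plus; apply Csum_ext; intros k _; ring.
Qed.

Lemma conv_scal_l (c : C) (f g : nat -> C) (n : nat) :
  conv (fun k => c * f k) g n = c * conv f g n.
Proof.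
  unfold conv; rewrite <- Csum_scal; apply Csum_ext; intros k _; ring.
Qed.

Lemma conv_scal_r (c : C) (f g : nat -> C) (n : nat) :
  conv f (fun k => c * g k) n = c * conv f g n.
Proof.
  unfold conv; rewrite <- Csum_scal; apply Csum_ext; intros k _; ring.
Qed.

Lemma conv_plus_r (f g g' : nat -> C) (n : nat) :
  conv f (fun k => g k + g' k) n = conv f g n + conv f g' n.
Proof.
  unfold conv; rewrite <- Csum_plus; apply Csum_ext; intros k _; ring.
Qed.

Lemma conv_fone_r (f : nat -> C) (n : nat) : conv f fone n = f n.
Proof.
  revert f; induction n as [|n IH]; intros f.
  - unfold conv; rewrite sum_O; simpl; ring.
  - rewrite conv_S, IH; simpl; ring.
Qed.

(** Splitting off the constant coefficient of [f] reduces degree n + 1 to degree n for all series at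
    once, with no exchange of double sums. *)
Lemma conv_assoc (f g h : nat -> C) (n : nat) :
  conv (conv f g) h n = conv f (conv g h) n.
Proof.
  revert f g h; induction n as [|n IH]; intros f g h.
  - unfold conv; rewrite !sum_O; simpl; ring.
  - rewrite conv_S.
    rewrite (conv_ext _ (fun k => f O * g (S k) + conv (fun k => f (S k)) g k)
      h h) by (try intros k; try apply conv_S; reflexivity).
    rewrite conv_plus_l, conv_scal_l, IH, (conv_S f), (conv_S g).
    unfold conv at 1; rewrite sum_O; simpl; ring.
Qed.

Lemma conv_fshift_r (f g : nat -> C) (n : nat) :
  conv f (fshift g) n = fshift (conv f g) n.
Proof.
  destruct n as [|n].
  - unfold conv; rewrite sum_O; simpl; ring.
  - rewrite conv_S_r; simpl fshift.
    rewrite (conv_ext f f _ g) by reflexivity; ring.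
Qed.

(** The substitution of w z for z respects products. *)
Lemma conv_geom (w : C) (f g : nat -> C) (n : nat) :
  conv (fun k => w ^ k * f k) (fun k => w ^ k * g k) n = w ^ n * conv f g n.
Proof.
  unfold conv; rewrite <- Csum_scal; apply Csum_ext; intros k Hk.
  replace (w ^ n) with (w ^ k * w ^ (n - k))
    by (rewrite <- Cpow_add_r; f_equal; lia).
  ring.
Qed.

Lemma fexp_S (a : C) (n : nat) : INR (S n) * fexp a (S n) = a * fexp a n.
Proof.
  unfold fexp; rewrite INR_fact_S_C, Cpow_S.
  field; split; [apply INR_fact_C_neq_0 | apply INR_S_C_neq_0].
Qed.

(** Leibniz rule for the formal derivative: the weight n + 1 splits as k + (n + 1 - k) in each
    term. *)
Lemma conv_deriv (f g : nat -> C) (n : nat) :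
  INR (S n) * conv f g (S n)
  = conv (fun k => INR (S k) * f (S k)) g n
    + conv f (fun k => INR (S k) * g (S k)) n.
Proof.
  transitivity (conv (fun k => INR k * f k) g (S n)
    + conv f (fun k => INR k * g k) (S n)).
  - unfold conv; rewrite <- Csum_scal, <- Csum_plus.
    apply Csum_ext; intros k Hk.
    replace (INR (S n)) with (INR k + INR (S n - k))%R
      by (rewrite <- plus_INR; f_equal; lia).
    rewrite RtoC_plus; ring.
  - rewrite conv_S, conv_S_r; simpl (INR 0); ring.
Qed.

(** Both sides solve y' = (a + b) y with y(0) = 1, so their coefficients agree by induction. *)
Lemma conv_fexp (a b : C) (n : nat) :
  conv (fexp a) (fexp b) n = fexp (a + b) n.
Proof.
  induction n as [|n IH].
  - unfold conv, fexp; rewrite sum_O; simpl; field.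
  - assert (H : INR (S n) * conv (fexp a) (fexp b) (S n)
                = INR (S n) * fexp (a + b) (S n)).
    { rewrite conv_deriv, fexp_S, <- IH.
      rewrite (conv_ext _ (fun k => a * fexp a k) (fexp b) (fexp b))
        by (try intros k; try apply fexp_S; reflexivity).
      rewrite (conv_ext (fexp a) (fexp a) _ (fun k => b * fexp b k))
        by (try intros k; try apply fexp_S; reflexivity).
      rewrite conv_scal_l, conv_scal_r; ring. }
    apply (f_equal (fun z => z / INR (S n))) in H.
    replace (conv (fexp a) (fexp b) (S n)) with
      (INR (S n) * conv (fexp a) (fexp b) (S n) / INR (S n))
      by (field; apply INR_S_C_neq_0).
    rewrite H; field; apply INR_S_C_neq_0.
Qed.

(** * Coefficients of the Bernoulli generating function *)

(** With an arbitrary factor [k], real parts alone carry all the information about a complex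
    series. *)
Lemma is_series_Re_mult (k : C) (a : nat -> C) (l : C) :
  is_series a l -> is_series (fun n => Re (k * a n)) (Re (k * l)).
Proof.
  intros H.
  assert (Hk : is_series (fun n => k * a n) (k * l))
    by exact (is_series_scal (K := C_AbsRing) (V := C_NormedModule) k a l H).
  unfold is_series in Hk |- *.
  apply (filterlim_ext (fun n => Re (sum_n (fun n => k * a n) n))).
  - intros n; now rewrite Re_sum_n, sum_n_Reals.
  - eapply filterlim_comp; [exact Hk |].
    intros P [e He]; exists e; intros y [Hy _]; now apply He.
Qed.

(** Strictly outside the disc of convergence the terms do not tend to 0. *)
Lemma CV_radius_ge (a : nat -> R) (r : R) :
  (0 <= r)%R -> ex_pseries a r -> Rbar_le r (CV_radius a).
Proof.
  intros Hr Hs; apply Rbar_not_lt_le; intros Hlt.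
  apply (CV_disk_outside a r).
  - now rewrite (Rabs_pos_eq r).
  - apply ex_series_lim_0; apply ex_pseries_R, Hs.
Qed.

(** Taylor coefficients are read off from an explicit sequence of successive derivatives. *)
Lemma PSeries_coef_of_derivatives (a : nat -> R) (g : nat -> R -> R) (n : nat) :
  Rbar_lt 0 (CV_radius a) ->
  (forall m t, is_derive (g m) t (g (S m) t)) ->
  locally 0%R (fun t => PSeries a t = g O t) ->
  (a n * INR (fact n))%R = g n 0%R.
Proof.
  intros Ha Hg Hloc.
  rewrite <- (Derive_n_coef a n Ha), (Derive_n_ext_loc _ _ n _ Hloc).
  assert (H : forall t, Derive_n (g O) n t = g n t); [| apply H].
  induction n as [|n IH]; intros t; [reflexivity |].
  simpl; rewrite (Derive_ext _ _ _ IH); apply is_derive_unique, Hg.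
Qed.

Lemma is_derive_Re_Cexp (c x : C) (t : R) :
  is_derive (fun t : R => Re (c * Cexp (x * t))) t (Re (c * x * Cexp (x * t))).
Proof.
  destruct c as [c d], x as [p q].
  assert (H : forall (c d s : R), Re ((c, d) * Cexp ((p, q) * s))
    = (exp (p * s) * (c * cos (q * s) - d * sin (q * s)))%R).
  { intros c' d' s; unfold Cexp; simpl.
    replace (p * s - q * 0)%R with (p * s)%R by ring.
    replace (p * 0 + q * s)%R with (q * s)%R by ring.
    ring. }
  apply (is_derive_ext _ _ _ _ (fun s => eq_sym (H c d s))).
  change ((c, d) * (p, q)) with ((c * p - d * q)%R, (c * q + d * p)%R).
  rewrite H; auto_derive; [trivial | ring].
Qed.

(** By the Leibniz rule [g m] is the m-th derivative of Re (k t e^(x t)); for m = 0 the factor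
    [INR 0] removes the term with the truncated exponent. *)
Lemma is_derive_Re_mult_Cexp (k x : C) (m : nat) (t : R) :
  let g (m : nat) (t : R) := Re (k * (x ^ m * t + INR m * x ^ (m - 1)) * Cexp (x * t)) in
  is_derive (g m) t (g (S m) t).
Proof.
  intros g.
  apply (is_derive_ext (fun t : R =>
    (t * Re (k * x ^ m * Cexp (x * t))
     + Re (k * (INR m * x ^ (m - 1)) * Cexp (x * t)))%R)).
  - intros s; unfold g; rewrite <- re_scal_l, <- re_plus; f_equal; ring.
  - evar_last.
    + apply @is_derive_plus.
      * apply (is_derive_mult (fun t : R => t)); [apply @is_derive_id | |].
        { apply is_derive_Re_Cexp. }
        intros; apply Rmult_comm.
      * apply is_derive_Re_Cexp.
    + unfold g; change plus with Rplus; change mult with Rmult;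
        change (one : R_AbsRing) with 1%R.
      rewrite Rmult_1_l, <- re_scal_l, <- !re_plus; f_equal.
      rewrite S_INR, RtoC_plus, Nat.sub_succ, Nat.sub_0_r.
      destruct m as [|m].
      * simpl; ring.
      * rewrite Nat.sub_succ, Nat.sub_0_r, !Cpow_S; ring.
Qed.

(** Dropping the first coefficient and shifting back replaces the constant term 1 of the exponential
    series by 0; known facts on both operations give convergence and value. *)
Definition expm1_coef : nat -> R :=
  PS_incr_1 (PS_decr_1 (fun n => / INR (fact n))%R).

Lemma ex_pseries_expm1 (t : R) : ex_pseries expm1_coef t.
Proof.
  apply ex_pseries_incr_1, ex_pseries_decr_1.
  - destruct (Req_dec t 0) as [H | H]; [now left | right].
    exists (/ t)%R; now apply Rinv_l.
  - eexists; apply is_exp_Reals.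
Qed.

Lemma PSeries_expm1 (t : R) : PSeries expm1_coef t = (exp t - 1)%R.
Proof.
  unfold expm1_coef; rewrite PSeries_incr_1, exp_Reals.
  rewrite (PSeries_decr_1 (fun n => / INR (fact n))%R).
  - simpl; field.
  - eexists; apply is_exp_Reals.
Qed.

Lemma expm1_coefE (n : nat) : RtoC (expm1_coef n) = fexp 1 n + -1 * fone n.
Proof.
  unfold expm1_coef, fexp; rewrite Cpow_1_l; destruct n as [|n].
  - simpl; unfold zero; simpl. field.
  - unfold PS_incr_1, PS_decr_1, fone.
    rewrite RtoC_inv by apply INR_fact_neq_0; field.
    apply INR_fact_C_neq_0.
Qed.

(* Restricting the generating function to real arguments [t] makes [e ^ t - 1]
   real, so that real Cauchy products of [Re (k * _)] suffice. *)
Lemma bernoulli_conv (B : nat -> C -> C) (x : C) (n : nat) :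
  is_bernoulli B ->
  conv (fun k => fexp 1 k + -1 * fone k) (fun k => B k x / INR (fact k)) n
  = INR n * x ^ (n - 1) / INR (fact n).
Proof.
  intros HB.
  assert (Hk : forall k : C,
    Re (k * conv (fun k => fexp 1 k + -1 * fone k)
        (fun k => B k x / INR (fact k)) n)
     = Re (k * (INR n * x ^ (n - 1) / INR (fact n)))).
  (* k = 1 gives the real parts and k = -i the imaginary parts. *)
  2:{ generalize (Hk 1) (Hk (- Ci)).
      set (u := conv _ _ n); set (v := _ / _).
      destruct u as [u1 u2], v as [v1 v2]; simpl; intros H1 H2.
      f_equal; lra. }
  intros k.
  set (p := fun m => Re (k * (B m x / INR (fact m)))).
  assert (Hp : forall t : R, t <> 0%R -> (Rabs t < 2 * PI)%R ->
    is_pseries p t (Re (k * (t * Cexp (x * t) / (exp t - 1)%R)))).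
  { intros t Ht0 Ht.
    assert (Hs := HB x t).
    rewrite Cmod_R in Hs.
    specialize (Hs (fun H => Ht0 (RtoC_inj _ _ H)) Ht).
    apply (is_series_Re_mult k) in Hs.
    assert (He : Cexp t - 1 = (exp t - 1)%R).
    { unfold Cexp; simpl; rewrite cos_0, sin_0, RtoC_minus.
      change (1, 0)%R with (RtoC 1); ring. }
    rewrite He in Hs; apply is_pseries_R.
    eapply is_series_ext; [| exact Hs].
    intros m; unfold p; rewrite <- RtoC_pow, <- re_scal_r; f_equal.
    field; apply INR_fact_C_neq_0. }
  assert (HPI : (2 < PI)%R) by (generalize PI2_1; lra).
  (* Convergence at the single point t = 1, nonzero and inside the disc, bounds the radius from
     below. *)
  assert (Rp : Rbar_le 1%R (CV_radius p)).
  { apply CV_radius_ge; [lra |].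
    eexists; apply Hp; [| rewrite Rabs_R1]; lra. }
  assert (Ru : Rbar_le 1%R (CV_radius expm1_coef))
    by (apply CV_radius_ge; [lra | apply ex_pseries_expm1]).
  assert (Hin : forall (a : nat -> R) (t : R), Rbar_le 1%R (CV_radius a) ->
    (Rabs t < 1)%R -> Rbar_lt (Rabs t) (CV_radius a))
    by (intros a t Ha Ht; exact (Rbar_lt_le_trans (Rabs t) 1%R _ Ht Ha)).
  (* Near 0 the product series sums to Re (k t e^(x t)), whose derivatives at 0 are explicit. *)
  assert (Hc := PSeries_coef_of_derivatives (PS_mult expm1_coef p)
    (fun m t => Re (k * (x ^ m * t + INR m * x ^ (m - 1)) * Cexp (x * t))) n).
  cbv beta in Hc.
  assert (HR : PS_mult expm1_coef p n
    = Re (k * conv (fun k => fexp 1 k + -1 * fone k)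
        (fun k => B k x / INR (fact k)) n)).
  { unfold conv, PS_mult; rewrite <- Csum_scal, Re_sum_n.
    apply sum_eq; intros i _; rewrite <- expm1_coefE.
    unfold p; rewrite <- re_scal_l; f_equal; ring. }
  rewrite <- HR.
  apply (Rmult_eq_reg_r (INR (fact n))); [| apply INR_fact_neq_0].
  rewrite Hc.
  - rewrite <- re_scal_r; f_equal.
    replace (Cexp (x * RtoC 0)) with (RtoC 1).
    + field; apply INR_fact_C_neq_0.
    + unfold Cexp; rewrite Cmult_0_r; simpl.
      rewrite exp_0, cos_0, sin_0; change (1, 0)%R with (RtoC 1); ring.
  (* The point 1/2 lies inside both discs of convergence, so the product converges there and has
     positive radius. *)
  - apply (Rbar_lt_le_trans _ (/ 2)%R); [simpl; lra |].
    apply CV_radius_ge; [lra |].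
    apply ex_pseries_mult; apply Hin; trivial; rewrite Rabs_pos_eq; lra.
  - intros m t; apply is_derive_Re_mult_Cexp.
  - exists (mkposreal 1 Rlt_0_1); intros t Ht.
    assert (Ht' : (Rabs t < 1)%R).
    { replace t with (t - 0)%R by ring; exact Ht. }
    rewrite PSeries_mult by (apply Hin; trivial).
    rewrite PSeries_expm1.
    (* The generating function is not given at t = 0, but there e^t - 1 and t both vanish; elsewhere
       e^t - 1 cancels the denominator. *)
    destruct (Req_dec t 0) as [-> | Ht0].
    + rewrite exp_0; simpl.
      replace (k * (1 * 0 + 0 * 1) * Cexp (x * 0)) with (RtoC 0) by ring.
      simpl; ring.
    + rewrite (is_pseries_unique _ _ _ (Hp t Ht0 ltac:(lra))).
      assert (He : (exp t - 1 <> 0)%R).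
      { intros He; apply Ht0, exp_inv; rewrite exp_0; lra. }
      rewrite <- re_scal_l; f_equal; simpl; field.
      intros H; apply He, RtoC_inj, H.
Qed.

(** * Bernoulli binomial sums with general parameters *)

(** Since e^((b+w)z) - e^(bz) = e^(bz) (e^(wz) - 1), associativity brings e^(wz) - 1 next to the
    Bernoulli series at w z, and their product is w z e^(xwz). *)
Lemma bernoulli_exp_diff_conv (B : nat -> C -> C) (b w x : C) (n : nat) :
  is_bernoulli B ->
  conv (fun k => fexp (b + w) k + -1 * fexp b k)
    (fun k => w ^ k * (B k x / INR (fact k))) n
  = w * (INR n * (b + x * w) ^ (n - 1)) / INR (fact n).
Proof.
  intros HB.
  rewrite (conv_ext _ (conv (fexp b) (fun k => fexp w k + -1 * fone k)) _
    (fun k => w ^ k * (B k x / INR (fact k)))).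
  2:{ intros k; now rewrite conv_plus_r, conv_scal_r, conv_fexp, conv_fone_r. }
  2:{ reflexivity. }
  rewrite conv_assoc.
  rewrite (conv_ext (fexp b) (fexp b) _
    (fun k => w * fshift (fexp (x * w)) k)).
  - rewrite conv_scal_r, conv_fshift_r; destruct n as [|n].
    + simpl; field.
    + simpl fshift; rewrite conv_fexp, INR_fact_S_C, Nat.sub_succ, Nat.sub_0_r.
      unfold fexp; field.
      split; [apply INR_fact_C_neq_0 | apply INR_S_C_neq_0].
  - reflexivity.
  - intros m.
    (* This is [bernoulli_conv] with w z substituted for z. *)
    rewrite (conv_ext _ (fun k => w ^ k * (fexp 1 k + -1 * fone k)) _
      (fun k => w ^ k * (B k x / INR (fact k)))).
    + rewrite conv_geom, bernoulli_conv by assumption; destruct m as [|m].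
      * simpl; field.
      * simpl fshift; rewrite INR_fact_S_C, Nat.sub_succ, Nat.sub_0_r.
        unfold fexp; rewrite Cpow_mult_l, Cpow_S; field.
        split; [apply INR_fact_C_neq_0 | apply INR_S_C_neq_0].
    + intros k; unfold fexp; rewrite Cpow_1_l.
      destruct k as [|k]; simpl fone.
      * simpl; field.
      * field; apply INR_fact_C_neq_0.
    + reflexivity.
Qed.

(** Multiplication by n! turns the weights 1 / (k! (n - k)!) in the product of exponential
    generating functions into binomial coefficients. *)
Lemma bernoulli_binomial_sum (B : nat -> C -> C) (b w x : C) (n : nat) :
  is_bernoulli B ->
  sum_n (fun k => Binomial.C n k * ((b + w) ^ k - b ^ k) * w ^ (n - k)
    * B (n - k)%nat x) n
  = w * (INR n * (b + x * w) ^ (n - 1)).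
Proof.
  intros HB.
  transitivity (INR (fact n) * conv (fun k => fexp (b + w) k + -1 * fexp b k)
    (fun k => w ^ k * (B k x / INR (fact k))) n).
  - unfold conv; rewrite <- Csum_scal; apply Csum_ext; intros k _.
    unfold Binomial.C, fexp.
    rewrite RtoC_div, RtoC_mult
      by (apply Rmult_integral_contrapositive; split; apply INR_fact_neq_0).
    field; split; apply INR_fact_C_neq_0.
  - rewrite bernoulli_exp_diff_conv by assumption.
    (* The equality is recast at type [C] so that [field] applies. *)
    change (@eq _ ?u ?v) with (@eq C u v).
    field; apply INR_fact_C_neq_0.
Qed.

(** * Fibonacci numbers *)

(** Applied to both roots of r^2 = r + 1, this yields Binet's formula and expresses alpha^j and
    beta^j through F_j and F_(j-1). *)
Lemma pow_fib (r : R) (n : nat) :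
  (r ^ 2 = r + 1)%R -> (r ^ S n = r * INR (fib (S n)) + INR (fib n))%R.
Proof.
  intros Hr; induction n as [|n IH].
  - simpl; ring.
  - rewrite <- tech_pow_Rmult, IH.
    replace (fib (S (S n))) with (fib (S n) + fib n)%nat by reflexivity.
    rewrite plus_INR.
    transitivity (r ^ 2 * INR (fib (S n)) + r * INR (fib n))%R; [ring |].
    rewrite Hr; ring.
Qed.

Lemma alpha_sqr : (alpha ^ 2 = alpha + 1)%R.
Proof.
  assert (H := sqrt_sqrt 5 ltac:(lra)); unfold alpha.
  transitivity ((1 + 2 * sqrt 5 + sqrt 5 * sqrt 5) / 4)%R; [field |].
  rewrite H; field.
Qed.

Lemma beta_sqr : (beta ^ 2 = beta + 1)%R.
Proof.
  assert (H := sqrt_sqrt 5 ltac:(lra)); unfold beta.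
  transitivity ((1 - 2 * sqrt 5 + sqrt 5 * sqrt 5) / 4)%R; [field |].
  rewrite H; field.
Qed.

(** Subtracting the expansions of the powers of both roots cancels F_(n-1), and alpha - beta = sqrt
    5. *)
Lemma binet (n : nat) : (sqrt 5 * INR (fib n) = alpha ^ n - beta ^ n)%R.
Proof.
  destruct n as [|n]; [simpl; ring |].
  rewrite (pow_fib alpha n alpha_sqr), (pow_fib beta n beta_sqr).
  unfold alpha, beta; field.
Qed.

Lemma binet_mul (j k : nat) :
  sqrt 5 * INR (fib (j * k)) = (RtoC (alpha ^ j)) ^ k - (RtoC (beta ^ j)) ^ k.
Proof.
  rewrite <- RtoC_mult, binet, !pow_mult, RtoC_minus.
  now rewrite !RtoC_pow.
Qed.

(** * The two Fibonacci-Bernoulli identities *)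

Theorem theorem13 :
  forall B : nat -> C -> C, is_bernoulli B ->
  forall (n j : nat) (x : C), (1 <= j)%nat ->
    sum_n (fun k : nat =>
        Binomial.C n k * INR (fib (j * k)) *
        (sqrt 5 * INR (fib j)) ^ (n - k) * B (n - k)%nat x) n
    = INR n * INR (fib j) *
      ((sqrt 5 * x + beta) * INR (fib j) + INR (fib (j - 1))) ^ (n - 1)
    /\
    sum_n (fun k : nat =>
        Binomial.C n k * INR (fib (j * k)) *
        (- sqrt 5 * INR (fib j)) ^ (n - k) * B (n - k)%nat x) n
    = INR n * INR (fib j) *
      ((alpha - sqrt 5 * x) * INR (fib j) + INR (fib (j - 1))) ^ (n - 1).
Proof.
  intros B HB n j x Hj.
  assert (H5 : RtoC (sqrt 5) <> 0).
  { intros H; apply RtoC_inj in H; generalize (sqrt_lt_R0 5); lra. }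
  assert (Hpow : forall r : R, (r ^ 2 = r + 1)%R ->
    RtoC (r ^ j) = r * INR (fib j) + INR (fib (j - 1))).
  { intros r Hr; destruct j as [|j]; [lia |].
    now rewrite pow_fib, RtoC_plus, RtoC_mult, Nat.sub_succ, Nat.sub_0_r. }
  assert (Ha := Hpow alpha alpha_sqr); assert (Hb := Hpow beta beta_sqr).
  (* With b = beta^j and w = sqrt 5 F_j, the base b + w is alpha^j; the opposite w leads back from
     alpha^j to beta^j. *)
  assert (Hw : RtoC (beta ^ j) + sqrt 5 * INR (fib j) = RtoC (alpha ^ j)).
  { rewrite <- RtoC_mult, binet, <- RtoC_plus; f_equal; ring. }
  assert (Hw' : RtoC (alpha ^ j) + - sqrt 5 * INR (fib j) = RtoC (beta ^ j))
    by (rewrite <- Hw; ring).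
  split.
  (* The factor 1 / sqrt 5 turns alpha^(jk) - beta^(jk) into F_(jk). *)
  - transitivity (/ sqrt 5 * (sqrt 5 * INR (fib j) *
      (INR n * (RtoC (beta ^ j) + x * (sqrt 5 * INR (fib j))) ^ (n - 1)))).
    + rewrite <- (bernoulli_binomial_sum B) by assumption.
      rewrite <- Csum_scal; apply Csum_ext; intros k _.
      rewrite Hw, <- binet_mul; field; exact H5.
    + replace (RtoC (beta ^ j) + x * (sqrt 5 * INR (fib j))) with
        ((sqrt 5 * x + beta) * INR (fib j) + INR (fib (j - 1)))
        by (rewrite Hb; ring).
      change (@eq _ ?u ?v) with (@eq C u v); field; exact H5.
  (* With alpha^j and beta^j exchanged the difference changes sign, hence the factor -1 / sqrt 5. *)
  - transitivity (- / sqrt 5 * (- sqrt 5 * INR (fib j) *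
      (INR n * (RtoC (alpha ^ j) + x * (- sqrt 5 * INR (fib j))) ^ (n - 1)))).
    + rewrite <- (bernoulli_binomial_sum B) by assumption.
      rewrite <- Csum_scal; apply Csum_ext; intros k _.
      rewrite Hw'.
      replace (RtoC (beta ^ j) ^ k - RtoC (alpha ^ j) ^ k)
        with (- (sqrt 5 * INR (fib (j * k)))) by (rewrite binet_mul; ring).
      field; exact H5.
    + replace (RtoC (alpha ^ j) + x * (- sqrt 5 * INR (fib j))) with
        ((alpha - sqrt 5 * x) * INR (fib j) + INR (fib (j - 1)))
        by (rewrite Ha; ring).
      change (@eq _ ?u ?v) with (@eq C u v); field; exact H5.
Qed.
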